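(* Let $G$ be a finite group and $\omega\in Z^3_{\mathrm{gp}}(G,U(1))$. The complexification of the character map is an isomorphism $$\chi\colon\mathrm{Rep}(D^\omega(G))\otimes\mathbb C\xrightarrow{\ \cong\ }\{\omega\text{-twisted elliptic characters of }G\},$$ and an orthonormal basis of the space of $\omega$-twisted elliptic characters of $G$ is given by the characters of the irreducible representations of $D^\omega(G)$.
   Context: Three-cocycles. $\omega\in Z^3_{\mathrm{gp}}(G,U(1))$ is a function $G^3\to U(1)$, normalized ($\omega=1$ if any argument is $e$), with $\omega(h,g,f)\,\omega(kh,g,f)^{-1}\,\omega(k,hg,f)\,\omega(k,h,gf)^{-1}\,\omega(k,h,g)=1$ for all $k,h,g,f\in G$. Twisted Drinfeld double. $D^\omega(G)$ (as an algebra) is the complex algebra with basis $\{\langle\xleftarrow{g}x\rangle : g,x\in G\}$ and product $$\langle\xleftarrow{h}y\rangle\cdot\langle\xleftarrow{g}x\rangle:=\delta_{y,gxg^{-1}}\frac{\omega(h,g,x)\,\omega(hgx(hg)^{-1},h,g)}{\omega(h,gxg^{-1},g)}\langle\xleftarrow{hg}x\rangle;$$ its unit is $\sum_x\langle\xleftarrow{e}x\rangle$. $\mathrm{Rep}(D^\omega(G))$ is the Grothendieck group of its finite-dimensional (unital) complex representations. Character. For a representation $\rho\colon D^\omega(G)\to\mathrm{End}(V)$, $\chi_\rho(g,x):=\mathrm{Tr}(\rho(\langle\xleftarrow{g}x\rangle))$; it vanishes unless $xg=gx$, and is regarded as a function on commuting pairs $(g,x)$. The character map is $[\rho]\mapsto\chi_\rho$.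 Elliptic characters. An $\omega$-twisted elliptic character of $G$ is a complex-valued function $\chi$ on pairs $(g,x)\in G\times G$ with $xg=gx$ such that for every $h\in G$ $$\chi(hgh^{-1},hxh^{-1})=\frac{\omega(h,x,g)\,\omega(hgh^{-1},h,x)\,\omega(hxh^{-1},hgh^{-1},h)}{\omega(h,g,x)\,\omega(hxh^{-1},h,g)\,\omega(hgh^{-1},hxh^{-1},h)}\,\chi(g,x).$$ The inner product on this space is $\langle\chi_1,\chi_2\rangle=\int_{\Lambda^2\overline G}\overline{\chi_1}\chi_2=\frac1{|G|}\sum_{xg=gx}\overline{\chi_1(g,x)}\,\chi_2(g,x)$. (Here $\Lambda^2\overline G$ is the groupoid whose objects are commuting pairs in $G$, with morphisms given by simultaneous conjugation by elements of $G$, and $\int$ weights each object by the reciprocal of the number of morphisms out of it.) *)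

(* Defs.v *)
From HB Require Import structures.
From mathcomp Require Import all_boot all_order fingroup all_algebra generic_quotient.
From mathcomp Require Import boolp reals complex freeg.
From mathcomp Require Import ring.

Set Implicit Arguments.
Unset Strict Implicit.
Unset Printing Implicit Defensive.

Import Order.TTheory GRing.Theory Num.Theory.
Local Open Scope ring_scope.
Local Open Scope quotient_scope.

Section Presented.
Variables (K : choiceType) (rel : {freeg K} -> Prop).

(* The subgroup of the free abelian group on K generated by the relators. *)
Definition relspan : {pred {freeg K}} :=
  fun u => `[< forall S : zmodClosed {freeg K},
                 (forall r, rel r -> r \in S) -> u \in S >].

Lemma relspan_zmod_closed : zmod_closed relspan.
Proof.
split=> [|u v /asboolP uS /asboolP vS]; apply/asboolP => S relS.
  exact: rpred0.
by rewrite rpredB ?uS ?vS.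
Qed.

HB.instance Definition _ :=
  GRing.isZmodClosed.Build {freeg K} relspan relspan_zmod_closed.

Lemma relspan_rel r : rel r -> r \in relspan.
Proof. by move=> rr; apply/asboolP => S; apply. Qed.

Definition presented := {ideal_quot relspan}.
HB.instance Definition _ := GRing.Zmodule.on presented.
HB.instance Definition _ := EqQuotient.on presented.

Definition presented_gen (x : K) : presented := \pi_presented << 1 *g x >>.

Lemma presented_piB : zmod_morphism (\pi_presented : {freeg K} -> presented).
Proof. exact: (raddfB (\pi_{ideal_quot relspan})). Qed.

HB.instance Definition _ :=
  GRing.isZmodMorphism.Build {freeg K} presented \pi_presented presented_piB.

Lemma presented_rel r : rel r -> \pi_presented r = 0.
Proof.
move=> rr; rewrite -(raddf0 \pi_presented); apply/eqP.
by rewrite -Quotient.idealrBE subr0 relspan_rel.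
Qed.

Lemma presented_genD x y z :
    rel (<< 1 *g x >> - << 1 *g y >> - << 1 *g z >>) ->
  presented_gen x = presented_gen y + presented_gen z.
Proof.
move=> /presented_rel; rewrite !presented_piB => /eqP.
by rewrite -addrA -opprD subr_eq0 => /eqP.
Qed.

Lemma eq_presented (M : zmodType) (f g : presented -> M) :
    zmod_morphism f -> zmod_morphism g ->
  (forall x, f (presented_gen x) = g (presented_gen x)) -> f =1 g.
Proof.
move=> fB gB fg q.
pose F : {additive presented -> M} :=
  HB.pack f (GRing.isZmodMorphism.Build presented M f fB).
pose G : {additive presented -> M} :=
  HB.pack g (GRing.isZmodMorphism.Build presented M g gB).
rewrite -[f]/(F : _ -> _) -[g]/(G : _ -> _) -(reprK q) -(freeg_sumE (repr q)).
rewrite !raddf_sum; apply: eq_bigr => x _.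
have -> : << coeff x (repr q) *g x >> = << 1 *g x >> *~ coeff x (repr q).
  by rewrite freeg_mulz intz.
by rewrite !raddfMz; congr (_ *~ _); apply: fg.
Qed.

Section Lift.
Variables (M : zmodType) (f : K -> M).

Definition presented_lift (q : presented) : M :=
  @fglift int (zmodule M) K f (repr q).

Let L : {freeg K} -> M := @fglift int (zmodule M) K f.

Let LB : zmod_morphism L.
Proof. exact: (@lift_is_additive int K (zmodule M) f). Qed.

Lemma fglift_sub2 x y z : f x = f y + f z ->
  L (<< 1 *g x >> - << 1 *g y >> - << 1 *g z >>) = 0.
Proof.
have L1 k : L << 1 *g k >> = f k.
  by rewrite /L (@liftU int (zmodule M)) scale1r.
by move=> e; rewrite !LB !L1 e addrAC addrK subrr.
Qed.

Hypothesis f_rel : forall r, rel r -> @fglift int (zmodule M) K f r = 0.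

Lemma presented_lift_pi u :
  presented_lift (\pi_presented u) = @fglift int (zmodule M) K f u.
Proof.
pose L' : {additive {freeg K} -> M} :=
  HB.pack L (GRing.isZmodMorphism.Build {freeg K} M L LB).
apply/eqP; rewrite -subr_eq0 /presented_lift -/L -[L]/(L' : _ -> _) -raddfB.
have /asboolP : repr (\pi_presented u) - u \in relspan.
  by rewrite Quotient.idealrBE reprK.
pose S : {pred {freeg K}} := fun v => L' v == 0.
have S_closed : zmod_closed S.
  split=> [|v w]; rewrite !unfold_in ?raddf0 // => /eqP v0 /eqP w0.
  by rewrite raddfB v0 w0 subrr.
pose S' : zmodClosed {freeg K} :=
  HB.pack S (GRing.isZmodClosed.Build _ S S_closed).
by move=> /(_ S'); apply=> r /f_rel fr0; rewrite unfold_in /= /S; apply/eqP.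
Qed.

Lemma presented_lift_gen x : presented_lift (presented_gen x) = f x.
Proof. by rewrite presented_lift_pi liftU scale1r. Qed.

Lemma presented_liftB : zmod_morphism presented_lift.
Proof.
move=> p q; rewrite -(reprK p) -(reprK q) -raddfB !presented_lift_pi.
exact: LB.
Qed.

End Lift.
End Presented.

(* A \otimes_Z V, with scalars acting on the right-hand factor. *)
Section Tensor.
Variables (F : pzRingType) (A : zmodType) (V : lmodType F).

Variant tensor_rel : {freeg (A * V)} -> Prop :=
| TensorRelDl a a' v :
    tensor_rel (<< 1 *g (a + a', v) >> - << 1 *g (a, v) >> - << 1 *g (a', v) >>)
| TensorRelDr a v v' :
    tensor_rel (<< 1 *g (a, v + v') >> - << 1 *g (a, v) >> - << 1 *g (a, v') >>).

Definition tensor := presented tensor_rel.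
HB.instance Definition _ := GRing.Zmodule.on tensor.

Definition tens (a : A) (v : V) : tensor := presented_gen tensor_rel (a, v).

Definition tensor_scale (c : F) : tensor -> tensor :=
  presented_lift (fun p : A * V => tens p.1 (c *: p.2)).

Lemma tensDl a a' v : tens (a + a') v = tens a v + tens a' v.
Proof.
exact/presented_genD/TensorRelDl.
Qed.

Lemma tensDr a v v' : tens a (v + v') = tens a v + tens a v'.
Proof.
exact/presented_genD/TensorRelDr.
Qed.

Lemma tensor_scale_rel c r : tensor_rel r ->
  @fglift int (zmodule tensor) _ (fun p : A * V => tens p.1 (c *: p.2)) r = 0.
Proof.
by case=> *; apply: fglift_sub2; rewrite /= ?scalerDr ?tensDl ?tensDr.
Qed.

Lemma tensor_scale_tens c a v : tensor_scale c (tens a v) = tens a (c *: v).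
Proof. exact: presented_lift_gen (@tensor_scale_rel c) _. Qed.

Lemma tensor_scaleB c : zmod_morphism (tensor_scale c).
Proof. exact: presented_liftB (@tensor_scale_rel c). Qed.

Lemma tensor_scaleA c d t :
  tensor_scale c (tensor_scale d t) = tensor_scale (c * d) t.
Proof.
pose f := tensor_scale c \o tensor_scale d.
apply: (@eq_presented _ _ _ f); first by move=> p q; rewrite /f /= !tensor_scaleB.
  exact: tensor_scaleB.
by case=> a v; rewrite /f /= -/(tens a v) !tensor_scale_tens scalerA.
Qed.

Lemma tensor_scale1 : left_id 1 tensor_scale.
Proof.
apply: (@eq_presented _ _ _ _ id) => //; first exact: tensor_scaleB.
by case=> a v; rewrite -/(tens a v) tensor_scale_tens scale1r.
Qed.

Lemma tensor_scaleDr : right_distributive tensor_scale +%R.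
Proof.
move=> c p q; have cB := tensor_scaleB c.
have c0 : tensor_scale c 0 = 0 by have := cB 0 0; rewrite !subrr.
have cN : tensor_scale c (- q) = - tensor_scale c q.
  by rewrite -[- q]add0r cB c0 add0r.
by rewrite -{1}[q]opprK cB cN opprK.
Qed.

Lemma tensor_scaleDl t : {morph tensor_scale^~ t : c d / c + d}.
Proof.
move=> c d; pose f q := tensor_scale c q + tensor_scale d q.
apply: (@eq_presented _ _ _ _ f); first exact: tensor_scaleB.
  by move=> p q; rewrite /f !tensor_scaleB opprD addrACA.
by case=> a v; rewrite /f -/(tens a v) !tensor_scale_tens scalerDl tensDr.
Qed.

HB.instance Definition _ := GRing.Zmodule_isLmodule.Build F tensor
  tensor_scaleA tensor_scale1 tensor_scaleDr tensor_scaleDl.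

End Tensor.

Section Representations.
Variables (F : fieldType) (A : algType F).

(* A left module structure on the space 'cV_fdrep_dim of column vectors. *)
Record fdrep := FdRep {
  fdrep_dim : nat;
  fdrep_act :> {lrmorphism A -> 'M[F]_fdrep_dim} }.

HB.instance Definition _ := gen_eqMixin fdrep.
HB.instance Definition _ := gen_choiceMixin fdrep.

Definition fdrep_hom (r s : fdrep) (f : 'M[F]_(fdrep_dim s, fdrep_dim r)) :=
  forall a, f *m r a = s a *m f.

Definition fdrep_iso (r s : fdrep) :=
  exists f, fdrep_hom (r := r) (s := s) f /\
    bijective (fun v : 'cV_(fdrep_dim r) => f *m v).

Definition fdrep_stable (r : fdrep) (U : {vspace 'cV[F]_(fdrep_dim r)}) :=
  forall a v, v \in U -> r a *m v \in U.

Definition fdrep_irr (r : fdrep) :=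
  (0 < fdrep_dim r)%N /\
  forall U, fdrep_stable (r := r) U -> U = 0%VS \/ U = fullv.

Definition irr_system n (irr : 'I_n -> fdrep) :=
  [/\ forall i, fdrep_irr (irr i),
      forall i j, fdrep_iso (irr i) (irr j) -> i = j
    & forall r, fdrep_irr r -> exists i, fdrep_iso r (irr i)].

Definition fdrep_ses (r' r r'' : fdrep) :=
  exists f g,
    [/\ fdrep_hom (r := r') (s := r) f, fdrep_hom (r := r) (s := r'') g,
        injective (fun v : 'cV_(fdrep_dim r') => f *m v),
        forall v : 'cV_(fdrep_dim r), g *m v = 0 <-> exists u, v = f *m u
      & forall w : 'cV_(fdrep_dim r''), exists v, w = g *m v].

(* All short exact sequences are used as relations, not only split ones. *)
Variant groth_rel : {freeg fdrep} -> Prop :=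
| GrothRel r' r r'' of fdrep_ses r' r r'' :
    groth_rel (<< 1 *g r >> - << 1 *g r' >> - << 1 *g r'' >>).

Definition groth := presented groth_rel.
HB.instance Definition _ := GRing.Zmodule.on groth.

Definition groth_class (r : fdrep) : groth := presented_gen groth_rel r.

End Representations.

Section TwistedDouble.
Variables (R : realType) (gT : finGroupType).
Implicit Types g h k x y : gT.

Record cocycle3 := Cocycle3 {
  cocycle3_fun :> gT -> gT -> gT -> R[i];
  cocycle3_U1 : forall h g f, `|cocycle3_fun h g f| = 1;
  cocycle3_norm : forall h g, [/\ cocycle3_fun 1%g h g = 1,
    cocycle3_fun h 1%g g = 1 & cocycle3_fun h g 1%g = 1];
  cocycle3P : forall k h g f,
    cocycle3_fun h g f * (cocycle3_fun (k * h)%g g f)^-1 *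
    cocycle3_fun k (h * g)%g f * (cocycle3_fun k h (g * f)%g)^-1 *
    cocycle3_fun k h g = 1 }.

(* The cocycle is a phantom argument on which the product depends. *)
Definition tdd (w : cocycle3) : Type := {ffun gT * gT -> R[i]^o}.

Variable w : cocycle3.
Local Notation D := (tdd w).

HB.instance Definition _ := GRing.Lmodule.copy D {ffun gT * gT -> R[i]^o}.

(* The indicator of (g, x) is the arrow labelled g with source x. *)
Definition tdd_basis (g x : gT) : D := [ffun p => (p == (g, x))%:R].

Definition tdd_coef (h g x : gT) : R[i] :=
  w h g x * w ((h * g) * x * (h * g)^-1)%g h g / w h (g * x * g^-1)%g g.

Definition tdd_mul (a b : D) : D :=
  \sum_(p : gT * gT) \sum_(q : gT * gT) (a p * b q) *:
    (((p.2 == q.1 * q.2 * q.1^-1)%g%:R * tdd_coef p.1 q.1 q.2) *: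
      tdd_basis (p.1 * q.1)%g q.2).

Definition tdd_one : D := \sum_x tdd_basis 1%g x.

Lemma w_neq0 h g f : w h g f != 0.
Proof. by rewrite -normr_eq0 cocycle3_U1 oner_eq0. Qed.

Lemma w_norm h g : (w 1%g h g = 1) * (w h 1%g g = 1) * (w h g 1%g = 1).
Proof. by have [-> -> ->] := cocycle3_norm w h g. Qed.

Lemma w_eq k h g f : w h g f * w k (h * g)%g f * w k h g =
  w (k * h)%g g f * w k h (g * f)%g.
Proof.
have := cocycle3P w k h g f.
have := w_neq0 (k * h) g f; have := w_neq0 k h (g * f) => n1 n2 e.
rewrite -[RHS]mul1r -e; field; exact/andP.
Qed.

Lemma tdd_coefP k h g x :
  tdd_coef k (h * g) x * tdd_coef h g x =
  tdd_coef (k * h) g x * tdd_coef k h (g * x * g^-1).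
Proof.
set Y := (g * x * g^-1)%g; set Z := (h * Y * h^-1)%g.
set W := (k * Z * k^-1)%g.
have EZ : ((h * g) * x * (h * g)^-1)%g = Z by rewrite /Z /Y invMg !mulgA.
have EW : ((k * h) * Y * (k * h)^-1)%g = W by rewrite /W /Z invMg !mulgA.
have EW' : ((k * h * g) * x * (k * h * g)^-1)%g = W.
  by rewrite -EW /Y !invMg !mulgA.
rewrite /tdd_coef -/Y [(k * (h * g))%g]mulgA EW' EZ EW.
have := w_eq k h g x; have := w_eq W k h g.
have := w_eq k h Y g; have := w_eq k Z h g.
have -> : (Y * g = g * x)%g by rewrite mulgKV.
have -> : (Z * h = h * Y)%g by rewrite mulgKV.
have -> : (W * k = k * Z)%g by rewrite mulgKV.
move=> e1 e2 e3 e4.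
have nz := w_neq0.
have E1 : w Z h g = w (k * Z)%g h g * w k Z (h * g)%g / (w k (h * Y)%g g * w k Z h).
  by rewrite -e1; field; rewrite !nz.
have E2 : w k h Y = w (k * h)%g Y g * w k h (g * x)%g / (w h Y g * w k (h * Y)%g g).
  by rewrite -e2; field; rewrite !nz.
have E3 : w W k (h * g)%g = w k h g * w W (k * h)%g g * w W k h / w (k * Z)%g h g.
  by rewrite [w k h g * _]mulrC [_ * w k h g]mulrC e3; field; rewrite !nz.
have E4 : w k (h * g)%g x = w (k * h)%g g x * w k h (g * x)%g / (w h g x * w k h g).
  by rewrite -e4; field; rewrite !nz.
by rewrite E1 E2 E3 E4; field; rewrite !nz.
Qed.

Lemma tdd_sum (a : D) : a = \sum_p a p *: tdd_basis p.1 p.2.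
Proof.
apply/ffunP => q; rewrite sum_ffunE (bigD1 q) //= big1 ?addr0 => [|p pq].
  by rewrite !ffunE -surjective_pairing eqxx [_ *: _]mulr1.
by rewrite !ffunE -surjective_pairing eq_sym (negPf pq) scaler0.
Qed.

Fact tdd_mulDl : left_distributive tdd_mul +%R.
Proof.
move=> a b c; rewrite /tdd_mul -big_split; apply: eq_bigr => p _.
rewrite -big_split; apply: eq_bigr => q _.
by rewrite ffunE mulrDl scalerDl.
Qed.

Fact tdd_mulDr : right_distributive tdd_mul +%R.
Proof.
move=> a b c; rewrite /tdd_mul -big_split; apply: eq_bigr => p _.
rewrite -big_split; apply: eq_bigr => q _.
by rewrite ffunE mulrDr scalerDl.
Qed.

Fact tdd_scaleAl c (a b : D) : c *: tdd_mul a b = tdd_mul (c *: a) b.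
Proof.
rewrite /tdd_mul scaler_sumr; apply: eq_bigr => p _.
rewrite scaler_sumr; apply: eq_bigr => q _.
by rewrite ffunE scalerA [c * _]mulrA.
Qed.

Fact tdd_scaleAr c (a b : D) : c *: tdd_mul a b = tdd_mul a (c *: b).
Proof.
rewrite /tdd_mul scaler_sumr; apply: eq_bigr => p _.
rewrite scaler_sumr; apply: eq_bigr => q _.
by rewrite ffunE scalerA [c * _]mulrCA.
Qed.

Lemma tdd_mul_basis h y g x : tdd_mul (tdd_basis h y) (tdd_basis g x) =
  ((y == g * x * g^-1)%g%:R * tdd_coef h g x) *: tdd_basis (h * g)%g x.
Proof.
rewrite /tdd_mul (bigD1 (h, y)) //= [X in _ + X]big1 ?addr0 => [|p pN]; last first.
  by rewrite big1 // => q _; rewrite ffunE (negPf pN) mul0r scale0r.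
rewrite (bigD1 (g, x)) //= big1 ?addr0 => [|p pN]; last first.
  by rewrite !ffunE (negPf pN) mulr0 scale0r.
by rewrite !ffunE !eqxx mul1r scale1r.
Qed.

Fact tdd_suml I r (P : pred I) (f : I -> D) b :
  tdd_mul (\sum_(i <- r | P i) f i) b = \sum_(i <- r | P i) tdd_mul (f i) b.
Proof.
apply: (big_morph (tdd_mul^~ b)) => [a c|]; first exact: tdd_mulDl.
by rewrite -(scale0r 0) -tdd_scaleAl !scale0r.
Qed.

Fact tdd_sumr I r (P : pred I) (f : I -> D) b :
  tdd_mul b (\sum_(i <- r | P i) f i) = \sum_(i <- r | P i) tdd_mul b (f i).
Proof.
apply: (big_morph (tdd_mul b)) => [a c|]; first exact: tdd_mulDr.
by rewrite -(scale0r 0) -tdd_scaleAr !scale0r.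
Qed.

Lemma tdd_ind (P : D -> Prop) :
    (forall a b, P a -> P b -> P (a + b)) -> (forall c a, P a -> P (c *: a)) ->
  (forall g x, P (tdd_basis g x)) -> forall a, P a.
Proof.
move=> PD PZ PB a; rewrite (tdd_sum a); elim/big_ind: _ => // [|p _].
  by rewrite -(scale0r (tdd_basis 1 1)); apply: PZ.
exact: PZ.
Qed.

Fact tdd_mulA : associative tdd_mul.
Proof.
move=> a b c; elim/tdd_ind: a => [a a' ea ea'|d a ea|k z].
- by rewrite !tdd_mulDl ea ea'.
- by rewrite -!tdd_scaleAl ea.
elim/tdd_ind: b => [b b' eb eb'|d b eb|h y].
- by rewrite tdd_mulDl !tdd_mulDr tdd_mulDl eb eb'.
- by rewrite -tdd_scaleAl -!tdd_scaleAr -tdd_scaleAl eb.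
elim/tdd_ind: c => [c c' ec ec'|d c ec|g x].
- by rewrite !tdd_mulDr ec ec'.
- by rewrite -!tdd_scaleAr ec.
rewrite !tdd_mul_basis -tdd_scaleAr -tdd_scaleAl !tdd_mul_basis !scalerA.
rewrite [(k * (h * g))%g]mulgA.
congr (_ *: _); have [-> | yN] := eqVneq y (g * x * g^-1)%g; last first.
  by rewrite !mul0r mulr0.
have -> : ((h * g) * x * (h * g)^-1 = h * (g * x * g^-1) * h^-1)%g.
  by rewrite invMg !mulgA.
have [_ | zN] := eqVneq z (h * (g * x * g^-1) * h^-1)%g; last first.
  by rewrite !mul0r mulr0.
by rewrite !mul1r [LHS]mulrC tdd_coefP mulrC.
Qed.

Fact tdd_mul1 : left_id tdd_one tdd_mul.
Proof.
move=> a; rewrite {1}(tdd_sum a) [RHS]tdd_sum tdd_sumr; apply: eq_bigr.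
case=> g x _ /=; rewrite -tdd_scaleAr; congr (_ *: _).
rewrite tdd_suml (bigD1 (g * x * g^-1)%g) //= big1 ?addr0 => [|y yN].
  by rewrite tdd_mul_basis eqxx /tdd_coef !w_norm !mul1r invr1 scale1r mul1g.
by rewrite tdd_mul_basis (negPf yN) mul0r scale0r.
Qed.

Fact tdd_mulr1 : right_id tdd_one tdd_mul.
Proof.
move=> a; rewrite {1}(tdd_sum a) [RHS]tdd_sum tdd_suml; apply: eq_bigr.
case=> g x _ /=; rewrite -tdd_scaleAl; congr (_ *: _).
rewrite tdd_sumr (bigD1 x) //= big1 ?addr0 => [|y yN].
  rewrite tdd_mul_basis invg1 mul1g mulg1 eqxx /tdd_coef !w_norm.
  by rewrite !mul1r invr1 scale1r mulg1.
by rewrite tdd_mul_basis invg1 mul1g mulg1 eq_sym (negPf yN) mul0r scale0r.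
Qed.

Fact tdd_one_neq0 : tdd_one != 0.
Proof.
apply/eqP => /ffunP /(_ (1%g, 1%g)); rewrite sum_ffunE (bigD1 1%g) //=.
rewrite big1 => [|x xN]; rewrite !ffunE ?eqxx; last first.
  by rewrite xpair_eqE eqxx eq_sym (negPf xN).
by move/eqP; rewrite addr0 oner_eq0.
Qed.

HB.instance Definition _ := GRing.Zmodule_isNzRing.Build D
  tdd_mulA tdd_mul1 tdd_mulr1 tdd_mulDl tdd_mulDr tdd_one_neq0.
HB.instance Definition _ := GRing.Lmodule_isLalgebra.Build R[i] D tdd_scaleAl.
HB.instance Definition _ := GRing.Lalgebra_isAlgebra.Build R[i] D tdd_scaleAr.

End TwistedDouble.

Section Elliptic.
Variables (R : realType) (gT : finGroupType) (w : cocycle3 R gT).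

Definition cpair : Type := {p : gT * gT | p.2 * p.1 == p.1 * p.2}%g.
HB.instance Definition _ := Finite.on cpair.

Lemma cpairJ_subproof (h : gT) (p : cpair) :
  let q := (h * (val p).1 * h^-1, h * (val p).2 * h^-1)%g in
  (q.2 * q.1 == q.1 * q.2)%g.
Proof.
by case: p => -[g x] /= /eqP c; rewrite -!mulgA !mulKg !(mulgA _ _ h^-1)%g c.
Qed.

Definition cpairJ (h : gT) (p : cpair) : cpair :=
  exist _ (h * (val p).1 * h^-1, h * (val p).2 * h^-1)%g (cpairJ_subproof h p).

Definition elliptic_coef (h g x : gT) : R[i] :=
  let g' := (h * g * h^-1)%g in
  let x' := (h * x * h^-1)%g in
  (w h x g * w g' h x * w x' g' h) / (w h g x * w x' h g * w g' x' h).

Definition elliptic : {pred {ffun cpair -> R[i]^o}} :=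
  fun chi => [forall h, forall p : cpair,
    chi (cpairJ h p) == elliptic_coef h (val p).1 (val p).2 * chi p].

Lemma elliptic_submod_closed : submod_closed elliptic.
Proof.
split=> [|c chi psi /forallP chiE /forallP psiE].
  by apply/forallP => h; apply/forallP => p; rewrite !ffunE mulr0.
apply/forallP => h; apply/forallP => p; rewrite !ffunE.
rewrite (eqP (forallP (chiE h) p)) (eqP (forallP (psiE h) p)) mulrDr.
by apply/eqP; congr (_ + _); rewrite /GRing.scale /= mulrCA.
Qed.

HB.instance Definition _ := GRing.isSubmodClosed.Build R[i]
  {ffun cpair -> R[i]^o} elliptic elliptic_submod_closed.

Record ellchar := EllChar {
  ellchar_val :> {ffun cpair -> R[i]^o};
  _ : ellchar_val \in elliptic }.

HB.instance Definition _ := [isSub for ellchar_val].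
HB.instance Definition _ := [Choice of ellchar by <:].
HB.instance Definition _ := [SubChoice_isSubLmodule of ellchar by <:].

Definition ellchar_dot (chi psi : ellchar) : R[i] :=
  #|gT|%:R^-1 * \sum_(p : cpair) (chi p)^* * psi p.

Definition orthonormal_basis n (b : 'I_n -> ellchar) :=
  (forall i j, ellchar_dot (b i) (b j) = (i == j)%:R) /\
  (forall chi : ellchar, exists! c : {ffun 'I_n -> R[i]}, chi = \sum_i c i *: b i).

Definition character (r : fdrep (tdd w)) : {ffun cpair -> R[i]^o} :=
  [ffun p : cpair => \tr (r (tdd_basis w (val p).1 (val p).2))].

End Elliptic.

(* Main.v *)
Require Import Defs.
From HB Require Import structures.
From mathcomp Require Import all_boot all_order fingroup all_algebra.
From mathcomp Require Import reals complex.
From mathcomp Require Import boolp freeg ring.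

(* D^w(G) is the twisted algebra of the action groupoid of G on itself by
   conjugation, and its basis arrows B(g,x) are invertible between their source
   and target.  Averaging f |-> sum_(g,x) B(g,x) f B(g,x)^-1 turns linear maps
   into D^w(G)-linear ones, so Schur's lemma gives the orthogonality relations
   for sum tr_s(B(g,x)) tr_r(B(g,x)^-1).  Since w has modulus 1, the hermitian
   form sum_(g,x) |B(g,x) v|^2 makes every arrow act unitarily, whence
   tr_r(B(g,x)^-1) is the conjugate of tr_r(B(g,x)).

   Completeness needs no semisimplicity: for psi elliptic, the element
   z = sum conj(psi(g,x)) B(g,x) is central; if psi is orthogonal to all
   irreducible characters then z acts as 0 on every irreducible, so z a has
   trace 0 on every representation by devissage, and the trace of
   z B(g,x)^-1 on the regular representation is |G| conj(psi(g,x)).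

   Devissage along short exact sequences also shows that the irreducible classes
   generate the Grothendieck group, which gives the inverse of the complexified
   character map. *)

Set Implicit Arguments.
Unset Strict Implicit.
Unset Printing Implicit Defensive.

Import Order.TTheory GRing.Theory Num.Theory.
Local Open Scope ring_scope.

(** * Matrices determined or factored column by column *)

Lemma col_mulmx (F : fieldType) m n p (f : 'M[F]_(m, n)) (X : 'M[F]_(n, p)) j :
  col j (f *m X) = f *m col j X.
Proof. by rewrite !colE mulmxA. Qed.

Lemma eq_col_mx (F : fieldType) m n (f g : 'M[F]_(m, n)) :
  (forall j, col j f = col j g) -> f = g.
Proof.
by move=> fg; apply/trmx_inj/row_matrixP => j; rewrite -!tr_col fg.
Qed.

Lemma eq_mulmx_cV (F : fieldType) m n (f g : 'M[F]_(m, n)) :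
  (forall v : 'cV_n, f *m v = g *m v) -> f = g.
Proof.
by move=> fg; apply: eq_col_mx => j; rewrite !colE.
Qed.

(** Preimages chosen column by column assemble into [Y]. This turns exactness, stated in [fdrep_ses]
    on vectors, into matrix identities. *)
Lemma mulmx_lift (F : fieldType) m n p (f : 'M[F]_(n, m)) (X : 'M[F]_(n, p)) :
  (forall j, exists u : 'cV_m, col j X = f *m u) -> exists Y, X = f *m Y.
Proof.
move=> /choice[u uE]; exists (\matrix_(i, j) u j i 0).
apply/matrixP => i j; have /matrixP/(_ i 0) := uE j; rewrite !mxE => ->.
by apply: eq_bigr => k _; rewrite mxE.
Qed.

(** * Representations of an algebra: exact sequences, devissage, Schur's lemma *)

Section Fdrep.
Variables (F : fieldType) (A : algType F).
Implicit Types r s : fdrep A.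

Section Build.
Variables (n : nat) (f : A -> 'M[F]_n).
Hypothesis f_lin : linear f.
Hypothesis f_1 : f 1 = 1%:M.
Hypothesis f_M : forall a b, f (a * b) = f a *m f b.

Let f_rmorph : {lrmorphism A -> 'M[F]_n} := HB.pack f
  (GRing.isLinear.Build F A 'M[F]_n *:%R f f_lin)
  (GRing.isMonoidMorphism.Build A 'M[F]_n f (f_1, f_M)).

Definition fdrep_of := FdRep f_rmorph.

End Build.

Lemma fdrepM r a b : r (a * b) = r a *m r b.
Proof. exact: rmorphM. Qed.

Lemma fdrepD r a b : r (a + b) = r a + r b.
Proof. exact: raddfD. Qed.

Lemma fdrepZ r c a : r (c *: a) = c *: r a.
Proof. exact: linearZ. Qed.

Lemma fdrep0 r : r 0 = 0.
Proof. exact: raddf0. Qed.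

Lemma fdrep_sum r I (P : pred I) e (f : I -> A) :
  r (\sum_(i <- e | P i) f i) = \sum_(i <- e | P i) r (f i).
Proof. exact: raddf_sum. Qed.

Lemma fdrep1 r : r 1 = 1%:M.
Proof. exact: rmorph1. Qed.

Lemma mulmx_cV_inj m n (f : 'M[F]_(n, m)) :
  injective (fun v : 'cV_m => f *m v) ->
  forall p (X Y : 'M_(m, p)), f *m X = f *m Y -> X = Y.
Proof.
move=> f_inj p X Y fXY; apply: eq_col_mx => j; apply: f_inj.
by rewrite -!col_mulmx fXY.
Qed.

(** A linear section [S] of [g] and a retraction [Y] of [f] split the sequence as vector spaces,
    [1 = f Y + S g]; cyclicity of the trace moves each summand to one end. Neither [S] nor [Y] need
    commute with the action. *)
Lemma fdrep_tr_ses r' r r'' a : fdrep_ses r' r r'' ->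
  \tr (r a) = \tr (r' a) + \tr (r'' a).
Proof.
case=> f [g [fH gH f_inj fg g_surj]].
have [S gS] : exists S, 1%:M = g *m S by apply: mulmx_lift => j; apply: g_surj.
have [Y fY] : exists Y, 1%:M - S *m g = f *m Y.
  apply: mulmx_lift => j; apply/fg.
  by rewrite -col_mulmx mulmxBr mulmx1 mulmxA -gS mul1mx subrr col0.
have gf : g *m f = 0.
  by apply: eq_mulmx_cV => u; rewrite mul0mx -mulmxA; apply/fg; exists u.
have Yf : Y *m f = 1%:M.
  apply: (mulmx_cV_inj f_inj).
  by rewrite mulmxA -fY mulmxBl mul1mx mulmx1 -mulmxA gf mulmx0 subr0.
have -> : r a = r a *m S *m g + r a *m f *m Y.
  by rewrite -!mulmxA -mulmxDr -fY addrC subrK mulmx1.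
rewrite raddfD /= addrC; congr (_ + _); rewrite mxtrace_mulC.
  by rewrite -fH mulmxA Yf mul1mx.
by rewrite mulmxA gH -mulmxA -gS mulmx1.
Qed.

Lemma fdrep_iso_refl r : fdrep_iso r r.
Proof.
exists 1%:M; split=> [a|]; first by rewrite mul1mx mulmx1.
by exists id => v; rewrite mul1mx.
Qed.

Lemma fdrep_isoP r s : fdrep_iso r s <-> exists f g,
  [/\ fdrep_hom (r := r) (s := s) f, f *m g = 1%:M & g *m f = 1%:M].
Proof.
split=> [[f [fH [h fK hK]]] | [f [g [fH fg gf]]]]; last first.
  exists f; split=> //; exists (mulmx g) => v; rewrite mulmxA.
    by rewrite gf mul1mx.
  by rewrite fg mul1mx.
have [g fg] : exists g, 1%:M = f *m g.
  by apply: mulmx_lift => j; exists (h (col j 1%:M)); rewrite hK.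
exists f, g; split=> //; apply: (mulmx_cV_inj (can_inj fK)).
by rewrite mulmxA -fg mul1mx mulmx1.
Qed.

Lemma fdrep_iso_sym r s : fdrep_iso r s -> fdrep_iso s r.
Proof.
case/fdrep_isoP=> f [g [fH fg gf]]; apply/fdrep_isoP; exists g, f; split=> // a.
by rewrite -[s a]mulmx1 -fg [s a *m _]mulmxA -fH -mulmxA mulmxA gf mul1mx.
Qed.

Lemma fdrep_iso_tr r s a : fdrep_iso r s -> \tr (r a) = \tr (s a).
Proof.
case/fdrep_isoP=> f [g [fH fg gf]].
by rewrite -[s a]mulmx1 -fg mulmxA -fH -mulmxA mxtrace_mulC -mulmxA gf mulmx1.
Qed.

Lemma fdrep_stable_ses r (U : {vspace 'cV[F]_(fdrep_dim r)}) :
    fdrep_stable U -> U <> 0%VS -> U <> fullv ->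
  exists r' r'', [/\ fdrep_ses r' r r'',
    (fdrep_dim r' < fdrep_dim r)%N & (fdrep_dim r'' < fdrep_dim r)%N].
Proof.
set n := fdrep_dim r => Ust U0 U1; set X := vbasis U.
(* The forms [coord X j] are defined on the whole space, so [L] is a left inverse of the inclusion
   [E]; it gives true coordinates only on [U]. *)
pose E : 'M[F]_(n, \dim U) := \matrix_(i, j) X`_j i 0.
pose L : 'M[F]_(\dim U, n) := \matrix_(j, i) coord X j (delta_mx i 0).
have EE c : E *m c = \sum_j c j 0 *: X`_j.
  apply/matrixP => i k; rewrite !mxE summxE; apply: eq_bigr => j _.
  by rewrite !mxE (ord1 k) mulrC.
have LE (v : 'cV_n) j : (L *m v) j 0 = coord X j v.
  rewrite [in RHS](matrix_sum_delta v) linear_sum !mxE; apply: eq_bigr => i _.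
  by rewrite big_ord1 linearZ !mxE mulrC.
have EU c : E *m c \in U.
  rewrite EE; apply: rpred_sum => j _; apply: rpredZ.
  by apply: vbasis_mem; rewrite mem_nth ?size_tuple.
have UE (v : 'cV_n) : v \in U -> v = E *m (L *m v).
  move=> vU; rewrite EE {1}(coord_vbasis vU); apply: eq_bigr => j _.
  by rewrite LE.
have L1 : L *m E = 1%:M.
  have X_free := basis_free (vbasisP U).
  apply: eq_col_mx => j; rewrite col_mulmx.
  have -> : col j E = X`_j.
    by apply/matrixP => k l; rewrite !mxE (ord1 l).
  by apply/matrixP => i k; rewrite (ord1 k) LE coord_free // !mxE eq_sym.
have m_n : (\dim U < n)%N.
  have <- : \dim (fullv : {vspace 'cV[F]_n}) = n by rewrite dimvf /dim /= muln1.
  rewrite ltn_neqAle dimvS ?subvf // andbT; apply/eqP => e; apply: U1.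
  by apply/eqP; rewrite eqEdim subvf e leqnn.
have m_gt0 : (0 < \dim U)%N.
  by rewrite lt0n dimv_eq0; apply/eqP.
have rE a : E *m (L *m (r a *m E)) = r a *m E.
  apply: eq_col_mx => j; rewrite !col_mulmx -UE //.
  by apply: Ust; rewrite -[E]mulmx1 col_mulmx.
have E_rank : \rank E = \dim U by apply/eqP/row_fullP; exists L.
have k_n : \rank (kermx E) = (n - \dim U)%N by rewrite mxrank_ker E_rank.
(* The columns of E are a basis of U and G is a matrix of the quotient map by U,
   with L and S their complementary one-sided inverses. *)
have [G [S [GE GS SG]]] :
    exists (G : 'M[F]_(\rank (kermx E), n)) (S : 'M_(n, _)),
    [/\ G *m E = 0, G *m S = 1%:M & S *m G = 1%:M - E *m L].
  pose G := row_base (kermx E).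
  have GE : G *m E = 0 by apply/sub_kermxP; rewrite eq_row_base.
  have /submxP[Y YG] : (1%:M - E *m L <= G)%MS.
    rewrite eq_row_base; apply/sub_kermxP.
    by rewrite mulmxBl mul1mx -mulmxA L1 mulmx1 subrr.
  have [T GT] : exists T, G *m T = 1%:M by apply/row_freeP/row_base_free.
  exists G, ((1%:M - E *m L) *m T); split=> //.
    by rewrite mulmxA mulmxBr mulmx1 mulmxA GE mul0mx subr0 GT.
  by rewrite YG -(mulmxA Y) GT mulmx1.
(* The action restricted to [U]. Stating the dimension as an equation keeps [s] abstract; the casts
   vanish once the equation is substituted. *)
have [s1 s1E] : exists s : fdrep A, exists e : fdrep_dim s = \dim U,
    forall a, s a = castmx (esym e, esym e) (L *m r a *m E).
  unshelve eexists (@fdrep_of (\dim U) (fun a => L *m r a *m E) _ _ _).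
  - by move=> c a b; rewrite /= linearP mulmxDr mulmxDl -scalemxAr -scalemxAl.
  - by rewrite /= fdrep1 mulmx1 L1.
  - by move=> a b; rewrite /= fdrepM -!mulmxA rE.
  by exists erefl.
have [s2 s2E] : exists s : fdrep A, exists e : fdrep_dim s = \rank (kermx E),
    forall a, s a = castmx (esym e, esym e) (G *m r a *m S).
  unshelve eexists (@fdrep_of _ (fun a => G *m r a *m S) _ _ _).
  - by move=> c a b; rewrite /= linearP mulmxDr mulmxDl -scalemxAr -scalemxAl.
  - by rewrite /= fdrep1 mulmx1 GS.
  (* The product of the compressions is off by [G (r a) E L (r b) S], which is 0 because [r a]
     preserves the image of [E] and [G] kills it. *)
  - move=> a b; rewrite /= fdrepM -!mulmxA (mulmxA S) SG mulmxBl mulmxBr mul1mx.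
    rewrite mulmxBr -!(mulmxA E) [r a *m (E *m _)]mulmxA -(rE a).
    by rewrite -!mulmxA (mulmxA G E) GE mul0mx subr0.
  by exists erefl.
exists s1, s2; case: s1 s1E => d1 s1 /= [e1]; subst d1 => s1E.
case: s2 s2E => d2 s2 /= [e2]; subst d2 => s2E.
split=> //; last by rewrite k_n ltn_subrL m_gt0 (leq_trans _ m_n).
exists E, G; split=> [a | a | | v | w] /=.
- by rewrite s1E castmx_id -!mulmxA rE.
- rewrite s2E castmx_id -!mulmxA SG mulmxBr mulmx1 mulmxBr.
  by rewrite [r a *m _]mulmxA -(rE a) -!mulmxA (mulmxA G E) GE mul0mx subr0.
- by move=> u v /(congr1 (mulmx L)); rewrite !mulmxA L1 !mul1mx.
- split=> [Gv|[u ->]]; last by rewrite mulmxA GE mul0mx.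
  exists (L *m v); apply/eqP; rewrite -subr_eq0 mulmxA -{1}[v]mul1mx -mulmxBl.
  by rewrite -SG -mulmxA Gv mulmx0.
- by exists (S *m w); rewrite mulmxA GS mul1mx.
Qed.

(** Strong induction on the dimension: a proper nonzero stable subspace gives a sequence with both
    ends smaller. Dimension 0 is a separate case, since [fdrep_irr] excludes it. *)
Lemma fdrep_ses_ind (P : fdrep A -> Prop) :
    (forall r, fdrep_dim r = 0%N -> P r) -> (forall r, fdrep_irr r -> P r) ->
    (forall r' r r'', fdrep_ses r' r r'' -> P r' -> P r'' -> P r) ->
  forall r, P r.
Proof.
move=> P0 Pirr Pses r; have [n] := ubnP (fdrep_dim r).
elim: n r => // n IHn r; rewrite ltnS => r_n.
have [d0|d_gt0] := posnP (fdrep_dim r); first exact: P0.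
have [/Pirr //|/not_andP[//|/existsNP[U]]] := pselect (fdrep_irr r).
move=> /not_implyP[Ust /not_orP[U0 U1]].
have [r' [r'' [ses lt' lt'']]] := fdrep_stable_ses Ust U0 U1.
by apply: Pses ses _ _; apply: IHn; apply: leq_trans r_n.
Qed.

Lemma groth_class_ses r' r r'' : fdrep_ses r' r r'' ->
  groth_class r = groth_class r' + groth_class r''.
Proof. by move=> ses; apply/presented_genD/GrothRel. Qed.

Lemma cV0_eq n (u v : 'cV[F]_n) : n = 0%N -> u = v.
Proof. by move=> n0; subst n; rewrite (flatmx0 u) flatmx0. Qed.

(** When all spaces are 0, the sequence [r], [r], [r] is short exact, so the class equals its own
    double. *)
Lemma groth_class_dim0 r : fdrep_dim r = 0%N -> groth_class r = 0.
Proof.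
move=> d0; have : fdrep_ses r r r.
  exists 0, 0; split=> [a|a|u v _|v|w]; rewrite ?mul0mx ?mulmx0 //.
  - exact: cV0_eq.
  - by split=> // _; exists v; apply: cV0_eq.
  - by exists w; apply: cV0_eq.
by move=> /groth_class_ses/eqP; rewrite -subr_eq subrr eq_sym => /eqP.
Qed.

(** Kept transparent so that its dimension computes to 0. *)
Let zero_rep : fdrep A.
Proof.
apply: (@fdrep_of 0 (fun=> 0)) => [c a b|| a b]; last by rewrite mulmx0.
  by rewrite scaler0 addr0.
by rewrite [RHS]flatmx0.
Defined.

(** An isomorphism is a short exact sequence with zero quotient. *)
Lemma fdrep_iso_groth_class r s :
  fdrep_iso r s -> groth_class r = groth_class s.
Proof.
case=> f [fH [g fK gK]].
have d0 : fdrep_dim zero_rep = 0%N by [].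
have /groth_class_ses : fdrep_ses r s zero_rep.
  exists f, 0; split=> // [a||v|w]; rewrite ?mul0mx ?mulmx0 //.
  - exact: can_inj fK.
  - by split=> // _; exists (g v); rewrite gK.
  - by exists 0; apply: cV0_eq.
by rewrite (groth_class_dim0 d0) addr0.
Qed.

(** Schur's lemma: the kernel and the image of [f] are stable subspaces. *)
Lemma fdrep_irr_hom r s f : fdrep_irr r -> fdrep_irr s ->
  fdrep_hom (r := r) (s := s) f -> f = 0 \/ fdrep_iso r s.
Proof.
case=> r0 rirr [s0 sirr] fH.
pose l : 'Hom('cV_(fdrep_dim r), 'cV_(fdrep_dim s)) := linfun (mulmx f).
have lE v : l v = f *m v by rewrite lfunE.
case: (rirr (lker l)) => [a v| k0 | kT].
- rewrite !memv_ker !lE mulmxA fH -mulmxA => /eqP ->.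
  by rewrite mulmx0.
- case: (sirr (limg l)) => [a _ /memv_imgP[v _ ->]| i0 | iT].
  + by rewrite lE mulmxA -fH -mulmxA -lE memv_img ?memvf.
  + left; apply: eq_mulmx_cV => v; rewrite mul0mx -lE; apply/eqP.
    by rewrite -memv0 -i0 memv_img ?memvf.
  + right; exists f; split=> //; exists (l^-1%VF) => v; rewrite -lE.
      by rewrite (lker0_lfunK (introT eqP k0)).
    by rewrite limg_lfunVK // iT memvf.
left; apply: eq_mulmx_cV => v; rewrite mul0mx -lE; apply/eqP.
by rewrite -memv_ker kT memvf.
Qed.

End Fdrep.

(** Schur's lemma again: for an eigenvalue [c], the kernel of [f - c] is stable and nonzero, hence
    everything. *)
Lemma fdrep_irr_endo (F : closedFieldType) (A : algType F) (r : fdrep A) f :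
  fdrep_irr r -> fdrep_hom (r := r) (s := r) f -> exists c, f = c%:M.
Proof.
case=> r0 rirr fH.
(* Eigenvectors are row vectors here, whence the transpose; positive dimension provides the root. *)
have [c] : exists c, root (char_poly f^T) c.
  by apply/closed_rootP; rewrite size_char_poly eqSS -lt0n.
rewrite -eigenvalue_root_char => /eigenvalueP[v vE v0]; exists c.
have fv : (f - c%:M) *m v^T = 0.
  rewrite mulmxBl mul_scalar_mx -linearZ -vE /=.
  by rewrite trmx_mul trmxK subrr.
pose l : 'End('cV_(fdrep_dim r)) := linfun (mulmx (f - c%:M)).
have lE u : l u = (f - c%:M) *m u by rewrite lfunE.
case: (rirr (lker l)) => [a u| k0 | kT].
- rewrite !memv_ker !lE => /eqP fu0.
  by rewrite mulmxA mulmxBl fH -scalar_mxC -mulmxBr -mulmxA fu0 mulmx0.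
- have : v^T \in lker l by rewrite memv_ker lE fv.
  by rewrite k0 memv0 trmx_eq0 (negPf v0).
apply/eqP; rewrite -subr_eq0; apply/eqP; apply: eq_mulmx_cV => u.
by rewrite mul0mx -lE; apply/eqP; rewrite -memv_ker kT memvf.
Qed.

(** * Calculus of arrows in the twisted double *)

Section TwistedDouble.
Variables (R : realType) (gT : finGroupType) (w : cocycle3 R gT).
Local Notation D := (tdd w).
Local Notation B := (tdd_basis w).
Local Notation coef := (tdd_coef w).
Implicit Types (g h x y : gT) (r s : fdrep D) (p : cpair gT).

Lemma tdd_coef_norm h g x : `|coef h g x| = 1.
Proof.
by rewrite /tdd_coef !(normrM, normfV) !cocycle3_U1 divr1 mulr1.
Qed.

Lemma tdd_coef_neq0 h g x : coef h g x != 0.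
Proof. by rewrite -normr_eq0 tdd_coef_norm oner_eq0. Qed.

Lemma tdd_coef_conj h g x : (coef h g x)^* = (coef h g x)^-1.
Proof.
have := normCK (coef h g x); rewrite tdd_coef_norm expr1n => e.
by apply: (mulfI (tdd_coef_neq0 h g x)); rewrite -e divff ?tdd_coef_neq0.
Qed.

Lemma tdd_coef1 g x : (coef g 1 x = 1) * (coef 1 g x = 1).
Proof. by rewrite /tdd_coef !w_norm !mul1r !invr1. Qed.

Lemma arrow_targetV g x : (g^-1 * (g * x * g^-1) * g^-1^-1 = x)%g.
Proof. by rewrite invgK !mulgA mulVg mul1g mulgKV. Qed.

(** The cocycle identity [tdd_coefP] at [g], [g^-1], [g]. It makes the left inverse [tdd_binv] a
    right inverse too. *)
Lemma tdd_coefV g x : coef g g^-1 (g * x * g^-1) = coef g^-1 g x.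
Proof.
by have := tdd_coefP w g g^-1 g x; rewrite mulVg mulgV !tdd_coef1 !mul1r => ->.
Qed.

Lemma tdd_basisM h y g x :
  B h y * B g x = ((y == g * x * g^-1)%g%:R * coef h g x) *: B (h * g)%g x.
Proof. exact: tdd_mul_basis. Qed.

Lemma tdd_basisJ h g x :
  B h (g * x * g^-1)%g * B g x = coef h g x *: B (h * g)%g x.
Proof. by rewrite tdd_basisM eqxx mul1r. Qed.

Lemma tdd_basis_neq h y g x : y != (g * x * g^-1)%g -> B h y * B g x = 0.
Proof. by rewrite tdd_basisM => /negPf ->; rewrite mul0r scale0r. Qed.

(* The groupoid inverse of the arrow (g, x), not an inverse in the algebra. *)
Definition tdd_binv g x : D := (coef g^-1 g x)^-1 *: B g^-1 (g * x * g^-1)%g.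

Lemma tdd_binvK g x : tdd_binv g x * B g x = B 1 x.
Proof.
by rewrite -scalerAl tdd_basisJ scalerA mulVf ?tdd_coef_neq0 // scale1r mulVg.
Qed.

Lemma tdd_basisK g x : B g x * tdd_binv g x = B 1 (g * x * g^-1)%g.
Proof.
rewrite -scalerAr -{2}(arrow_targetV g x) tdd_basisJ scalerA tdd_coefV.
by rewrite mulVf ?tdd_coef_neq0 // scale1r mulgV.
Qed.

Lemma tdd_basis1r g x : B g x * B 1 x = B g x.
Proof.
by have := tdd_basisJ g 1 x; rewrite invg1 mul1g !mulg1 tdd_coef1 scale1r.
Qed.

Lemma tdd_basis1l g x : B 1 (g * x * g^-1)%g * B g x = B g x.
Proof. by rewrite tdd_basisJ tdd_coef1 scale1r mul1g. Qed.

Lemma tdd_binv1l g x : B 1 x * tdd_binv g x = tdd_binv g x.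
Proof.
have := tdd_basis1l g^-1 (g * x * g^-1).
by rewrite arrow_targetV -scalerAr => ->.
Qed.

(** The scalar is the one in [tdd_basisJ], so shifting an average over arrows by [h] produces the
    same factor on both sides. *)
Lemma tdd_binv_basisM h g x :
  tdd_binv (h * g) x * B h (g * x * g^-1)%g = coef h g x *: tdd_binv g x.
Proof.
rewrite -[B h _]tdd_basis1r -tdd_basisK [B h _ * _]mulrA tdd_basisJ mulrA.
by rewrite -(scalerAr (coef h g x)) -scalerAl tdd_binvK tdd_binv1l.
Qed.

Lemma tdd_basisM_binv g h y :
  B (g * h)%g y * tdd_binv h y = (coef g h y)^-1 *: B g (h * y * h^-1)%g.
Proof.
rewrite -[B g _]tdd_basis1r -tdd_basisK mulrA tdd_basisJ -scalerAl scalerA.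
by rewrite mulVf ?tdd_coef_neq0 // scale1r.
Qed.

(** * Averaging over arrows and Schur orthogonality *)

Section Casimir.
Variables r s : fdrep D.

Definition fdrep_avg (f : 'M[R[i]]_(fdrep_dim s, fdrep_dim r)) :=
  \sum_g \sum_x s (B g x) *m f *m r (tdd_binv g x).

(** Tested on an arrow (h, y), with [g] replaced by [h * g] on the left. If [y] is not the target of
    (g, x), both terms vanish. *)
Lemma fdrep_avg_hom f : fdrep_hom (fdrep_avg f).
Proof.
elim/tdd_ind => [a b ea eb | c a ea | h y].
- by rewrite !fdrepD mulmxDr mulmxDl ea eb.
- by rewrite !fdrepZ -scalemxAr -scalemxAl ea.
rewrite /fdrep_avg mulmx_suml mulmx_sumr (reindex_inj (mulgI h)).
apply: eq_bigr => g _; rewrite mulmx_suml mulmx_sumr.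
apply: eq_bigr => x _; rewrite -mulmxA -fdrepM !mulmxA -fdrepM.
have [-> | yN] := eqVneq y (g * x * g^-1)%g.
  by rewrite tdd_binv_basisM tdd_basisJ !fdrepZ -scalemxAr -!scalemxAl.
rewrite tdd_basis_neq // -scalerAl tdd_basis_neq.
  by rewrite scaler0 !raddf0 !mul0mx.
apply: contra_neq yN => e; apply: (@mulgI _ h); apply: (@mulIg _ h^-1%g).
by rewrite -e invMg !mulgA.
Qed.

End Casimir.

(** Averaging the matrix unit E_ij and reading entry (i, j) gives products of diagonal entries s_ii
    r_jj, which sum to products of traces. This carries Schur's lemma over to characters. *)
Lemma fdrep_avg_tr r s :
  \sum_i \sum_j fdrep_avg (r := r) (s := s) (delta_mx i j) i j =
  \sum_g \sum_x \tr (s (B g x)) * \tr (r (tdd_binv g x)).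
Proof.
transitivity (\sum_i \sum_j \sum_g \sum_x
    s (B g x) i i * r (tdd_binv g x) j j).
  apply: eq_bigr => i _; apply: eq_bigr => j _.
  rewrite summxE; apply: eq_bigr => g _; rewrite summxE; apply: eq_bigr => x _.
  rewrite -(mul_delta_mx (0 : 'I_1)) mulmxA -colE -mulmxA -rowE.
  by rewrite mxE big_ord1 !mxE.
under eq_bigr do rewrite exchange_big; rewrite exchange_big.
apply: eq_bigr => g _; under eq_bigr do rewrite exchange_big.
rewrite exchange_big; apply: eq_bigr => x _.
by rewrite mulr_suml; apply: eq_bigr => i _; rewrite mulr_sumr.
Qed.

Lemma fdrep_irr_orth r s : fdrep_irr r -> fdrep_irr s -> ~ fdrep_iso r s ->
  \sum_g \sum_x \tr (s (B g x)) * \tr (r (tdd_binv g x)) = 0.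
Proof.
move=> rirr sirr rs; rewrite -fdrep_avg_tr.
rewrite big1 // => i _; rewrite big1 // => j _.
have [-> | //] := fdrep_irr_hom rirr sirr (fdrep_avg_hom (delta_mx i j)).
by rewrite mxE.
Qed.

Lemma tdd_basis_sum1 : \sum_x B 1 x = 1.
Proof. by []. Qed.

(** For each [g], cyclicity leaves the traces of [f *m r (B 1 x)], and the idempotents [B 1 x] sum
    to 1. *)
Lemma fdrep_avg_trace r f :
  \tr (fdrep_avg (r := r) (s := r) f) = #|gT|%:R * \tr f.
Proof.
rewrite raddf_sum -sum1_card natr_sum mulr_suml; apply: eq_bigr => g _.
rewrite mul1r -[in RHS](mulmx1 f) -fdrep1 -tdd_basis_sum1 fdrep_sum mulmx_sumr.
rewrite !raddf_sum; apply: eq_bigr => x _ /=.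
by rewrite -mulmxA mxtrace_mulC -mulmxA -fdrepM tdd_binvK.
Qed.

(** The average of E_ij is scalar, so its (i, j) entry is 0 off the diagonal; for i = j its trace is
    |G|, so the scalar is |G| divided by the dimension. *)
Lemma fdrep_irr_norm r : fdrep_irr r ->
  \sum_g \sum_x \tr (r (B g x)) * \tr (r (tdd_binv g x)) = #|gT|%:R.
Proof.
move=> rirr; have [d_gt0 _] := rirr.
have d0 : (fdrep_dim r)%:R != 0 :> R[i] by rewrite pnatr_eq0 -lt0n.
rewrite -fdrep_avg_tr.
transitivity (\sum_(i < fdrep_dim r) #|gT|%:R / (fdrep_dim r)%:R : R[i]);
  last first.
  by rewrite sumr_const card_ord -[LHS]mulr_natr mulfVK.
apply: eq_bigr => i _; rewrite (bigD1 i) //= big1 ?addr0 => [|j ji].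
  have [c cE] := fdrep_irr_endo rirr (fdrep_avg_hom (delta_mx i i)).
  have := fdrep_avg_trace (r := r) (delta_mx i i); rewrite cE mxtrace_scalar.
  rewrite mxE eqxx mulr1n => e; apply: (mulIf d0).
  rewrite mulfVK // mulr_natr e.
  rewrite /mxtrace (bigD1 i) //= big1 ?mxE ?eqxx ?addr0 ?mulr1 // => j ji.
  by rewrite mxE (negPf ji).
have [c ->] := fdrep_irr_endo rirr (fdrep_avg_hom (delta_mx i j)).
by rewrite mxE eq_sym (negPf ji).
Qed.

(** * Unitarity of the arrows *)

Local Notation "M ^H" := (map_mx Num.conj M)^T (at level 8, format "M ^H").

Lemma fdrep_tr_conj r g x :
  (\tr (r (B g x)))^* = \tr (r (tdd_binv g x)).
Proof.
(* The Gram matrix of the form sum |B(g,x) v|^2. *)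
pose H := \sum_g \sum_x (r (B g x))^H *m r (B g x).
have trH n (M : 'M[R[i]]_n) : (\tr M)^* = \tr M^H.
  by rewrite mxtrace_tr rmorph_sum; apply: eq_bigr => i _; rewrite mxE.
have mulH m n k (M : 'M[R[i]]_(m, n)) (N : 'M_(n, k)) : (M *m N)^H = N^H *m M^H.
  by rewrite map_mxM trmx_mul.
(* Term [k] on the left matches term [k * h] on the right. Only arrows composable with (h, y)
   survive, and the scalars, a conjugate and an inverse of [coef k h y], agree since it has modulus
   1. *)
have intertwine h y : (r (B h y))^H *m H = H *m r (tdd_binv h y).
  rewrite mulmx_sumr mulmx_suml [RHS](reindex_inj (mulIg h)).
  apply: eq_bigr => k _; rewrite mulmx_sumr mulmx_suml.
  rewrite (bigD1 (h * y * h^-1)%g) //= [RHS](bigD1 y) //=.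
  rewrite !big1 ?addr0 => [|z zy|z zy].
  - rewrite mulmxA -mulH -!mulmxA -!fdrepM tdd_basisM_binv tdd_basisJ !fdrepZ.
    by rewrite map_mxZ linearZ /= tdd_coef_conj -scalemxAl -scalemxAr.
  - rewrite -mulmxA -fdrepM -scalerAr tdd_basis_neq ?scaler0 ?arrow_targetV //.
    by rewrite fdrep0 mulmx0.
  - rewrite mulmxA -mulH -fdrepM tdd_basis_neq //.
    by rewrite fdrep0 map_mx0 trmx0 mul0mx.
(* If [v] is in the kernel, the squared norms of all [N k y] sum to 0, so each is 0; at [k = 1] the
   [N 1 y] add up to [v^H]. *)
have Hunit : H \in unitmx.
  rewrite unitmxE unitfE; apply/det0P => -[v v0 vH].
  pose N k y := r (B k y) *m v^H.
  have N_ge0 k y : 0 <= ((N k y)^H *m N k y) 0 0.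
    by rewrite mxE sumr_ge0 // => i _; rewrite !mxE mulrC mul_conjC_ge0.
  have NE : \sum_k \sum_y ((N k y)^H *m N k y) 0 0 = 0.
    transitivity ((v *m H *m v^H) 0 0); last by rewrite vH mul0mx mxE.
    rewrite mulmx_sumr mulmx_suml summxE; apply: eq_bigr => k _.
    rewrite mulmx_sumr mulmx_suml summxE; apply: eq_bigr => y _.
    rewrite /N mulH -!mulmxA; congr ((_ *m _) 0 0).
    by apply/matrixP => i j; rewrite !mxE conjCK.
  have N0 y : N 1%g y = 0.
    move/eqP: NE; rewrite psumr_eq0 => [|k _]; last exact: sumr_ge0.
    move=> /allP/(_ 1%g (mem_index_enum _)) /=; rewrite psumr_eq0 //.
    move=> /allP/(_ y (mem_index_enum _)) /=; rewrite mxE psumr_eq0 => [|i _].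
      move=> /allP N0; apply/matrixP => i j; rewrite (ord1 j) [RHS]mxE.
      have /= := N0 i (mem_index_enum _); rewrite !mxE mulrC mul_conjC_eq0.
      by move/eqP.
    by rewrite !mxE mulrC mul_conjC_ge0.
  have : v^H = 0.
    rewrite -[v^H]mul1mx -(fdrep1 r) -tdd_basis_sum1 fdrep_sum mulmx_suml.
    by rewrite big1 // => y _; apply: N0.
  move/(congr1 (fun M => M^H)); rewrite map_mx0 trmx0 => vHH.
  by case/eqP: v0; rewrite -vHH; apply/matrixP => i j; rewrite !mxE conjCK.
have -> : r (tdd_binv g x) = invmx H *m ((r (B g x))^H *m H).
  by rewrite intertwine mulmxA mulVmx // mul1mx.
by rewrite mxtrace_mulC -mulmxA mulmxV // mulmx1 trH.
Qed.

(** * Characters as elliptic functions *)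

Lemma elliptic_coefE h g x : (x * g = g * x)%g ->
  elliptic_coef w h g x = coef (h * g * h^-1)%g h x / coef h g x.
Proof.
move=> xg; rewrite /elliptic_coef /tdd_coef.
have -> : (h * g * h^-1 * h * x * (h * g * h^-1 * h)^-1 = h * x * h^-1)%g.
  by rewrite mulgKV invMg -(mulgA h) -xg !mulgA mulgK.
have -> : (h * g * x * (h * g)^-1 = h * x * h^-1)%g.
  by rewrite invMg -(mulgA h) -xg !mulgA mulgK.
have -> : (g * x * g^-1 = x)%g by rewrite -xg mulgK.
by field; rewrite !w_neq0.
Qed.

Lemma elliptic_coef_conj h g x : (x * g = g * x)%g ->
  (elliptic_coef w h g x)^* = coef h g x / coef (h * g * h^-1)%g h x.
Proof.
move=> /elliptic_coefE ->.
have := (tdd_coef_conj h g x, tdd_coef_conj (h * g * h^-1)%g h x).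
move: (coef _ _ _) (coef _ _ _) => c d [dE cE].
by rewrite rmorphM fmorphV /= dE cE invrK mulrC.
Qed.

Lemma cpair_comm p : ((val p).2 * (val p).1 = (val p).1 * (val p).2)%g.
Proof. exact/eqP/(valP p). Qed.

Lemma cpair_conj p : ((val p).1 * (val p).2 * (val p).1^-1 = (val p).2)%g.
Proof. by rewrite -cpair_comm mulgK. Qed.

(** Cycling the source idempotent [B 1 x] to the front of [B g x] gives 0 unless [x] is also the
    target. *)
Lemma tr_basis_neq r g x : (x * g)%g != (g * x)%g -> \tr (r (B g x)) = 0.
Proof.
move=> xg; rewrite -tdd_basis1r fdrepM mxtrace_mulC -fdrepM tdd_basis_neq.
  by rewrite fdrep0 mxtrace0.
by apply: contra_neq xg => {1}->; rewrite mulgKV.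
Qed.

(** Up to the ratio in [elliptic_coefE], [B g' x'] is [B g x] conjugated by the arrow (h, x), and
    the trace does not see conjugation. *)
Lemma character_elliptic r : character r \in elliptic w.
Proof.
apply/forallP => h; apply/forallP => p; apply/eqP.
rewrite !ffunE /=; set g := (val p).1; set x := (val p).2.
have xg : (x * g = g * x)%g := cpair_comm p.
rewrite elliptic_coefE //.
set g' := (h * g * h^-1)%g; set x' := (h * x * h^-1)%g.
have hgx : B h x * B g x = coef h g x *: B (h * g)%g x.
  by rewrite -tdd_basisJ cpair_conj.
have -> : B g' x' =
    (coef g' h x / coef h g x) *: (B h x * B g x * tdd_binv h x).
  rewrite -[LHS]tdd_basis1r -tdd_basisK mulrA tdd_basisJ hgx /g' mulgKV.
  move: (coef _ _ _) (coef _ _ _) (tdd_coef_neq0 h g x) => c d d0.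
  by rewrite -!scalerAl scalerA mulfVK.
rewrite fdrepZ mxtraceZ; congr (_ * _).
by rewrite -mulrA fdrepM mxtrace_mulC -fdrepM -mulrA tdd_binvK tdd_basis1r.
Qed.

Definition ell r : ellchar w := EllChar (character_elliptic r).

Lemma sum_cpair (F : gT * gT -> R[i]) :
    (forall q : gT * gT, (q.2 * q.1 != q.1 * q.2)%g -> F q = 0) ->
  \sum_(p : cpair gT) F (val p) = \sum_g \sum_x F (g, x).
Proof.
move=> F0; rewrite pair_big /=.
under [RHS]eq_bigr do rewrite -surjective_pairing.
rewrite [RHS](bigID (fun q : gT * gT => q.2 * q.1 == q.1 * q.2)%g) /=.
rewrite [X in _ + X]big1 ?addr0 // (reindex_omap (fun p => val p) insub) /=.
  apply: eq_bigl => p.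
  by rewrite valK eqxx andbT; apply/esym/(valP p).
by move=> q qP; rewrite insubT.
Qed.

Lemma ell_dot r s : ellchar_dot (ell r) (ell s) =
  #|gT|%:R^-1 * \sum_g \sum_x \tr (s (B g x)) * \tr (r (tdd_binv g x)).
Proof.
congr (_ * _); under eq_bigr do rewrite !ffunE fdrep_tr_conj mulrC.
pose F q := \tr (s (B q.1 q.2)) * \tr (r (tdd_binv q.1 q.2)).
rewrite (sum_cpair (F := F)) // /F.
by move=> q /(tr_basis_neq s) ->; rewrite mul0r.
Qed.

Lemma ell_iso r s : fdrep_iso r s -> ell r = ell s.
Proof.
by move=> rs; apply/val_inj/ffunP => p; rewrite !ffunE (fdrep_iso_tr _ rs).
Qed.

Lemma ell_irr_dot r s : fdrep_irr r -> fdrep_irr s ->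
  ellchar_dot (ell r) (ell s) = `[< fdrep_iso r s >]%:R.
Proof.
move=> rirr sirr; have [rs | rs] := asboolP; last first.
  by rewrite ell_dot fdrep_irr_orth // mulr0.
rewrite -(ell_iso rs) ell_dot fdrep_irr_norm // mulVf //.
by rewrite pnatr_eq0 -lt0n -cardsT cardG_gt0.
Qed.

Lemma ell_ses r' r r'' : fdrep_ses r' r r'' -> ell r = ell r' + ell r''.
Proof.
by move=> ses; apply/val_inj/ffunP => p; rewrite !ffunE (fdrep_tr_ses _ ses).
Qed.

(** * Regular representation and completeness *)

Lemma tdd_regular : exists r, forall g x,
  \tr (r (B g x)) = if (g == 1)%g then #|gT|%:R else 0.
Proof.
pose e (i : 'I_#|{: gT * gT}|) : D := B (enum_val i).1 (enum_val i).2.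
pose f (a : D) : 'M[R[i]]_#|{: gT * gT}| :=
  \matrix_(i, j) (a * e j) (enum_val i).
have eE i j : e j (enum_val i) = (i == j)%:R.
  by rewrite ffunE -surjective_pairing (inj_eq enum_val_inj).
have f_lin : linear f.
  move=> c a b; apply/matrixP => i j; rewrite !mxE mulrDl -scalerAl.
  by rewrite ffunE [X in X + _]ffunE.
have f1 : f 1 = 1%:M.
  by apply/matrixP => i j; rewrite !mxE mul1r eE.
have fM a b : f (a * b) = f a *m f b.
  apply/matrixP => i j; rewrite !mxE -mulrA [b * e j]tdd_sum mulr_sumr.
  rewrite sum_ffunE big_enum_val /=; apply: eq_bigr => k _.
  by rewrite -scalerAr ffunE !mxE mulrC.
exists (fdrep_of f_lin f1 fM) => g x /=.
rewrite /mxtrace.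
transitivity (\sum_(q : gT * gT) (B g x * B q.1 q.2) q).
  by rewrite [RHS]big_enum_val; apply: eq_bigr => i _; rewrite mxE.
transitivity (\sum_h \sum_y (B g x * B h y) (h, y)).
  by rewrite pair_big; apply: eq_bigr => -[].
have [-> | g1] := eqVneq g 1%g; last first.
  rewrite big1 // => h _; rewrite big1 // => y _; rewrite tdd_basisM !ffunE.
  have -> : ((h, y) == (g * h, y)%g) = false; last by rewrite scaler0.
  by apply: contra_neqF g1 => /eqP[e1]; apply: (@mulIg _ h); rewrite mul1g -e1.
rewrite -sum1_card natr_sum; apply: eq_bigr => h _.
(* The source of the arrow labelled [h] with target [x]: one arrow per [h] is fixed by [B 1 x],
   hence |G| in all. *)
rewrite (bigD1 (h^-1 * x * h)%g) //= big1 ?addr0 => [|y yN].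
  rewrite tdd_basisM !ffunE mul1g eqxx tdd_coef1 mulr1.
  by rewrite !mulgA mulgV mul1g mulgK eqxx scale1r.
rewrite tdd_basis_neq ?ffunE //; apply: contra_neq yN => ->.
by rewrite !mulgA mulVg mul1g mulgKV.
Qed.

Lemma cpairJ_inj h : injective (@cpairJ gT h).
Proof.
move=> p q /(congr1 val) [/mulIg/mulgI e1 /mulIg/mulgI e2]; apply/val_inj.
by rewrite [LHS]surjective_pairing [RHS]surjective_pairing e1 e2.
Qed.

Definition ell_center (psi : ellchar w) : D :=
  \sum_(p : cpair gT) (psi p)^* *: B (val p).1 (val p).2.

(** For an arrow (h, y), the pair [p] on the right matches its conjugate by [h] on the left.
    Ellipticity contributes a conjugated [elliptic_coef], which has modulus 1 and so cancels the
    ratio of the two product coefficients. *)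
Lemma ell_center_comm psi (a : D) : ell_center psi * a = a * ell_center psi.
Proof.
elim/tdd_ind: a => [a b ea eb | c a ea | h y].
- by rewrite mulrDl mulrDr ea eb.
- by rewrite -scalerAl -scalerAr ea.
rewrite /ell_center mulr_suml mulr_sumr (reindex_inj (@cpairJ_inj h)).
apply: eq_bigr => p _; rewrite -scalerAl -scalerAr /=.
set g := (val p).1; set x := (val p).2.
have xg : (x * g = g * x)%g := cpair_comm p.
have [-> | yx] := eqVneq y x; last first.
  rewrite !tdd_basis_neq ?scaler0 //; first by rewrite -xg mulgK.
  by apply: contra_neq yx => /mulIg/mulgI ->.
have psiE : ellchar_val psi \in elliptic w by case: psi.
have /forallP/(_ h)/forallP/(_ p)/eqP -> := psiE.
have -> : B h x * B g x = coef h g x *: B (h * g)%g x.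
  by rewrite -tdd_basisJ cpair_conj.
rewrite tdd_basisJ mulgKV !scalerA rmorphM /=; congr (_ *: _).
rewrite elliptic_coef_conj //.
have := tdd_coef_neq0 (h * g * h^-1)%g h x.
move: (coef _ _ _) (coef _ _ _) (psi p)^* => c d e d0.
by rewrite mulrAC mulfVK // mulrC.
Qed.

Lemma ell_complete psi :
  (forall r, fdrep_irr r -> ellchar_dot (ell r) psi = 0) -> psi = 0.
Proof.
move=> psi0; set z := ell_center psi.
have tr_z r : \tr (r z) = (#|gT|%:R * ellchar_dot (ell r) psi)^*.
  rewrite mulrA divff ?mul1r; last by rewrite pnatr_eq0 -lt0n -cardsT cardG_gt0.
  rewrite fdrep_sum !raddf_sum; apply: eq_bigr => p _ /=.
  by rewrite fdrepZ mxtraceZ rmorphM /= conjCK ffunE mulrC.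
(* Being central, [z] acts by a scalar; its trace is 0 and the dimension is nonzero in
   characteristic 0. *)
have z_irr r : fdrep_irr r -> r z = 0.
  move=> rirr; have [d_gt0 _] := rirr.
  have zH : fdrep_hom (r := r) (s := r) (r z).
    by move=> a; rewrite -!fdrepM ell_center_comm.
  have [c cE] := fdrep_irr_endo rirr zH.
  have /eqP := tr_z r; rewrite psi0 // mulr0 rmorph0 cE mxtrace_scalar.
  rewrite -mulr_natr mulf_eq0 pnatr_eq0 eqn0Ngt d_gt0 orbF => /eqP ->.
  by rewrite raddf0.
have tr_za r : forall a, \tr (r (z * a)) = 0.
  elim/fdrep_ses_ind: r => [r d0 a | r rirr a | r' r r'' ses IH' IH'' a].
  - rewrite /mxtrace big1 // => i _; have := ltn_ord i.
    by rewrite [X in (_ < X)%N]d0.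
  - by rewrite fdrepM z_irr // mul0mx mxtrace0.
  - by rewrite (fdrep_tr_ses _ ses) IH' IH'' addr0.
have [r rE] := tdd_regular; apply/val_inj/ffunP => p0; rewrite [RHS]ffunE.
set g := (val p0).1; set x := (val p0).2.
have := tr_za r (tdd_binv g x).
(* The regular trace of [B (val p).1 (val p).2 * tdd_binv g x] vanishes unless the sources agree and
   the labels cancel, so only [p0] contributes. *)
rewrite /z /ell_center mulr_suml fdrep_sum raddf_sum (bigD1 p0) //=.
rewrite big1 ?addr0 => [|p pN].
  rewrite -scalerAl tdd_basisK fdrepZ mxtraceZ rE eqxx => /eqP.
  rewrite mulf_eq0 conjC_eq0 pnatr_eq0 eqn0Ngt -cardsT cardG_gt0 orbF.
  by move/eqP.
rewrite -scalerAl fdrepZ mxtraceZ -scalerAr fdrepZ mxtraceZ.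
rewrite tdd_basisM arrow_targetV.
have [px|_] := eqVneq _ x; last by rewrite mul0r scale0r fdrep0 mxtrace0 !mulr0.
rewrite fdrepZ mxtraceZ rE; case: eqP => [/eqP|_]; last by rewrite !mulr0.
rewrite -eq_mulgV1 => /eqP pg; case/eqP: pN; apply/val_inj.
by rewrite [LHS]surjective_pairing [RHS]surjective_pairing pg px.
Qed.

(** * Orthonormal expansion in irreducible characters *)

Lemma ellchar_dot_sum n (c : 'I_n -> R[i]) (b : 'I_n -> ellchar w) chi :
  ellchar_dot chi (\sum_i c i *: b i) = \sum_i c i * ellchar_dot chi (b i).
Proof.
have vE p : ellchar_val (\sum_i c i *: b i) p = \sum_i c i * b i p.
  have -> : ellchar_val (\sum_i c i *: b i) = \sum_i c i *: ellchar_val (b i).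
    exact: (big_morph (@ellchar_val R gT w) (fun _ _ => erefl) erefl).
  by rewrite sum_ffunE; apply: eq_bigr => i _; rewrite ffunE.
rewrite /ellchar_dot; under eq_bigr do rewrite vE mulr_sumr.
rewrite exchange_big mulr_sumr; apply: eq_bigr => i _.
rewrite mulrCA; congr (_ * _); rewrite mulr_sumr.
by apply: eq_bigr => p _; rewrite mulrCA.
Qed.

Lemma ellchar_dotBr (chi psi phi : ellchar w) :
  ellchar_dot chi (psi - phi) = ellchar_dot chi psi - ellchar_dot chi phi.
Proof.
rewrite /ellchar_dot -mulrBr -sumrB; congr (_ * _); apply: eq_bigr => p _.
by rewrite -mulrBr; congr (_ * _); rewrite !ffunE.
Qed.

Lemma ellchar_dotZr (chi psi : ellchar w) c :
  ellchar_dot chi (c *: psi) = c * ellchar_dot chi psi.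
Proof.
rewrite /ellchar_dot mulrCA; congr (_ * _); rewrite mulr_sumr.
apply: eq_bigr => p _.
by rewrite mulrCA; congr (_ * _); rewrite ffunE.
Qed.

Section IrrSystem.
Variables (n : nat) (irr : 'I_n -> fdrep D).
Hypothesis irrP : irr_system irr.

Lemma irr_system_dot i j :
  ellchar_dot (ell (irr i)) (ell (irr j)) = (i == j)%:R.
Proof.
have [irr_irr irr_inj _] := irrP.
rewrite ell_irr_dot //; congr (nat_of_bool _)%:R.
apply/idP/eqP => [/asboolP/irr_inj //|->].
exact/asboolP/fdrep_iso_refl.
Qed.

(** The difference of the two sides is orthogonal to every irreducible character, so [ell_complete]
    applies. *)
Lemma irr_system_expand psi :
  psi = \sum_i ellchar_dot (ell (irr i)) psi *: ell (irr i).
Proof.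
have [irr_irr _ irr_all] := irrP.
apply/eqP; rewrite -subr_eq0; apply/eqP/ell_complete => r /irr_all[j rj].
rewrite (ell_iso rj) ellchar_dotBr ellchar_dot_sum (bigD1 j) //= big1 ?addr0.
  by rewrite irr_system_dot eqxx mulr1 subrr.
by move=> i ij; rewrite irr_system_dot eq_sym (negPf ij) mulr0.
Qed.

Lemma irr_system_orthonormal : orthonormal_basis (fun i => ell (irr i)).
Proof.
split=> [|psi]; first exact: irr_system_dot.
exists [ffun i => ellchar_dot (ell (irr i)) psi]; split.
  rewrite {1}[psi]irr_system_expand.
  by apply: eq_bigr => i _; rewrite ffunE.
move=> c psiE; apply/ffunP => i.
rewrite ffunE psiE ellchar_dot_sum (bigD1 i) //= big1 ?addr0 => [|j ji].
  by rewrite irr_system_dot eqxx mulr1.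
by rewrite irr_system_dot eq_sym (negPf ji) mulr0.
Qed.

End IrrSystem.

(** * Finiteness of the set of irreducible classes *)

Lemma irr_family_bound n (irr : 'I_n -> fdrep D) :
    (forall i, fdrep_irr (irr i)) ->
    (forall i j, fdrep_iso (irr i) (irr j) -> i = j) ->
  (n <= #|{: cpair gT}|)%N.
Proof.
move=> irr_irr irr_inj.
(* Orthonormality says that [M *m N] is the identity of size [n], factored through functions on
   commuting pairs. *)
pose M : 'M[R[i]]_(n, #|{: cpair gT}|) :=
  \matrix_(i, k) ell (irr i) (enum_val k).
pose N : 'M[R[i]]_(#|{: cpair gT}|, n) :=
  \matrix_(k, j) (#|gT|%:R^-1 * (ell (irr j) (enum_val k))^*).
apply: (@mulmx1_min _ _ _ M N); apply/matrixP => i j; rewrite !mxE.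
transitivity (ellchar_dot (ell (irr j)) (ell (irr i))).
  rewrite /ellchar_dot mulr_sumr [RHS]big_enum_val; apply: eq_bigr => k _.
  by rewrite !mxE mulrC mulrA.
rewrite ell_irr_dot //; congr (nat_of_bool _)%:R.
apply/idP/eqP => [/asboolP/irr_inj //|->].
exact/asboolP/fdrep_iso_refl.
Qed.

Lemma irr_system_exists :
  exists (n : nat) (irr : 'I_n -> fdrep D), irr_system irr.
Proof.
(* Orthogonality bounds the size of families of non-isomorphic irreducibles, and
   one of maximal size is complete. *)
pose P n := `[< exists irr : 'I_n -> fdrep D, (forall i, fdrep_irr (irr i)) /\
  (forall i j, fdrep_iso (irr i) (irr j) -> i = j) >].
have P0 : exists n, P n.
  have f0 : 'I_0 -> fdrep D by case.
  by exists 0%N; apply/asboolP; exists f0; split; case.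
have Pbound n : P n -> (n <= #|{: cpair gT}|)%N.
  by case/asboolP => irr []; apply: irr_family_bound.
case: (ex_maxnP P0 Pbound) => n /asboolP[irr [irr_irr irr_inj]] n_max.
exists n, irr; split=> // r rirr; apply: contrapT => /forallNP rN.
suff /n_max : P n.+1 by rewrite ltnn.
(* The missing irreducible [r] goes to index 0, the old family to the other indices. *)
apply/asboolP; exists (fun i => if unlift ord0 i is Some j then irr j else r).
split=> [i | i j]; first by case: unliftP.
case: unliftP => [i'|] ->; case: unliftP => [j'|] -> //.
- by move/irr_inj ->.
- by move/fdrep_iso_sym/rN.
- by move/rN.
Qed.

(** * The character map on the Grothendieck group and its complexification *)

Lemma groth_rel_ell u : groth_rel u ->
  @fglift int (zmodule (ellchar w)) (fdrep D) ell u = 0.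
Proof. by case=> r' r r'' ses; apply/fglift_sub2/ell_ses. Qed.

Definition ell_groth : groth D -> ellchar w := presented_lift ell.

Lemma ell_groth_class r : ell_groth (groth_class r) = ell r.
Proof. exact: presented_lift_gen groth_rel_ell _. Qed.

Lemma ell_groth_is_zmod_morphism : zmod_morphism ell_groth.
Proof. exact: presented_liftB groth_rel_ell. Qed.

HB.instance Definition _ :=
  GRing.isZmodMorphism.Build (groth D) (ellchar w) ell_groth
    ell_groth_is_zmod_morphism.

Let ell_scale (u : groth D * R[i]^o) : ellchar w := u.2 *: ell_groth u.1.

Lemma tensor_rel_ell u : tensor_rel u ->
  @fglift int (zmodule (ellchar w)) _ ell_scale u = 0.
Proof.
by case=> *; apply: fglift_sub2;
   rewrite /ell_scale /= ?raddfD ?scalerDr ?scalerDl.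
Qed.

Definition ell_tensor : tensor (groth D) R[i]^o -> ellchar w :=
  presented_lift ell_scale.

Lemma ell_tensor_tens a (z : R[i]^o) : ell_tensor (tens a z) = z *: ell_groth a.
Proof. exact: presented_lift_gen tensor_rel_ell _. Qed.

Lemma ell_tensor_is_zmod_morphism : zmod_morphism ell_tensor.
Proof. exact: presented_liftB tensor_rel_ell. Qed.

Lemma ell_tensor_is_scalable : scalable ell_tensor.
Proof.
move=> c; apply: eq_presented => [t u|t u|[a z]].
- by rewrite scalerBr ell_tensor_is_zmod_morphism.
- by rewrite ell_tensor_is_zmod_morphism scalerBr.
rewrite -/(tens a z) [c *: _]tensor_scale_tens !ell_tensor_tens.
by rewrite scalerA.
Qed.

HB.instance Definition _ := GRing.isZmodMorphism.Build
  (tensor (groth D) R[i]^o) (ellchar w) ell_tensor ell_tensor_is_zmod_morphism.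
HB.instance Definition _ := GRing.isScalable.Build R[i]
  (tensor (groth D) R[i]^o) (ellchar w) *:%R ell_tensor ell_tensor_is_scalable.

Lemma tens_is_zmod_morphism (z : R[i]^o) :
  zmod_morphism (fun a : groth D => tens a z).
Proof. by move=> a b; apply/(canRL (addrK _)); rewrite -tensDl subrK. Qed.

Lemma tens0r (a : groth D) : tens a (0 : R[i]^o) = 0.
Proof. by apply: (addrI (tens a 0)); rewrite -tensDr !addr0. Qed.

Lemma tens0l (z : R[i]^o) : tens (0 : groth D) z = 0.
Proof. by apply: (addrI (tens 0 z)); rewrite -tensDl !addr0. Qed.

Lemma ell_tensor_bij : bijective ell_tensor.
Proof.
have [n [irr irrP]] := irr_system_exists.
have [irr_irr _ irr_all] := irrP.
(* The orthonormal expansion, with each character replaced by its class. *)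
pose inv (psi : ellchar w) : tensor (groth D) R[i]^o :=
  \sum_i tens (groth_class (irr i)) (ellchar_dot (ell (irr i)) psi : R[i]^o).
have invB : zmod_morphism inv.
  move=> psi phi; rewrite -sumrB; apply: eq_bigr => i _.
  by apply/(canRL (addrK _)); rewrite -tensDr ellchar_dotBr subrK.
exists inv => [t | psi]; last first.
  rewrite raddf_sum [RHS](irr_system_expand irrP); apply: eq_bigr => i _.
  by rewrite [LHS]ell_tensor_tens ell_groth_class.
apply: (@eq_presented _ _ _ (inv \o ell_tensor) id) t => [t u|t u //|[a z]].
  by rewrite /= ell_tensor_is_zmod_morphism invB.
rewrite -/(tens a z) /= ell_tensor_tens.
(* For fixed [z] both sides are additive in the class, so generators suffice; devissage reduces
   these to irreducibles, where orthonormality leaves one summand. *)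
pose f (b : groth D) := inv (z *: ell_groth b).
apply: (@eq_presented _ _ _ f (fun b : groth D => tens b z) _ _ _ a).
- by move=> b c; rewrite /f raddfB scalerBr invB.
- exact: tens_is_zmod_morphism.
move=> r; rewrite -/(groth_class r) /f.
elim/fdrep_ses_ind: r => [r d0 | r rirr | r' r r'' ses e' e''].
- have inv0 : inv 0 = 0 by rewrite -(subrr 0) invB subrr.
  by rewrite groth_class_dim0 // raddf0 scaler0 tens0l.
- have [i /fdrep_iso_groth_class ->] := irr_all r rirr.
  rewrite ell_groth_class /inv (bigD1 i) //= big1 ?addr0 => [|j ji].
    by rewrite ellchar_dotZr irr_system_dot // eqxx mulr1.
  by rewrite ellchar_dotZr irr_system_dot // (negPf ji) mulr0 tens0r.
have invD psi phi : inv (psi + phi) = inv psi + inv phi.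
  by apply/eqP; rewrite -subr_eq -invB addrK.
by rewrite (groth_class_ses ses) raddfD scalerDr invD e' e'' tensDl.
Qed.

End TwistedDouble.

Theorem theorem20 (R : realType) (gT : finGroupType) (w : cocycle3 R gT) :
  exists chi : {additive groth (tdd w) -> ellchar w},
    [/\ forall r : fdrep (tdd w),
          ellchar_val (chi (groth_class r)) = character r,
        exists chiC : {linear tensor (groth (tdd w)) R[i]^o -> ellchar w},
          (forall (a : groth (tdd w)) (z : R[i]^o), chiC (tens a z) = z *: chi a) /\
          bijective chiC,
        exists (n : nat) (irr : 'I_n -> fdrep (tdd w)), irr_system irr
      & forall (n : nat) (irr : 'I_n -> fdrep (tdd w)), irr_system irr ->
          orthonormal_basis (fun i => chi (groth_class (irr i)))].
Proof.
exists (@ell_groth R gT w); split=> [r||| n irr irrP].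
- by rewrite /= ell_groth_class.
- exists (@ell_tensor R gT w); split; first exact: ell_tensor_tens.
  exact: ell_tensor_bij.
- exact: irr_system_exists.
have -> : (fun i => ell_groth (groth_class (irr i))) = fun i => ell (irr i).
  by apply/funext => i; rewrite ell_groth_class.
exact: irr_system_orthonormal.
Qed.
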